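(* Let $n\ge3$, $\varphi\in S_n$, and let $k,l$ be two different blocks of $\mathfrak{M}_{(n,\varphi)}$. Then $|k\cap l|\in\{0,1,2,n-2\}$. If both $k,l$ are $A$-blocks, or both $k,l$ are $B$-blocks, then $|k\cap l|=n-2$. Otherwise (up to interchanging $k$ and $l$) $k=A_i$ and $l=B_j$ for some $i,j\in I$, and the following equivalences hold: (i) $|A_i\cap B_j|=0$ iff $\varphi(j)=i=j$; (ii) $|A_i\cap B_j|=1$ iff ($\varphi(j)=i\neq j$ or $\varphi(j)\neq i=j$); (iii) $|A_i\cap B_j|=2$ iff ($\varphi(j)\neq i$ and $i\neq j$).
   Context: Let $n\ge 3$, $I=\{1,\dots,n\}$, $\varphi\in S_n$ a permutation of $I$, and let $A=\{a_1,\dots,a_n\}$, $B=\{b_1,\dots,b_n\}$ be disjoint $n$-element sets. For $i\in I$ put $A_i=(A\setminus\{a_i\})\cup\{b_i\}$ (the $A$-blocks) and $B_i=(B\setminus\{b_i\})\cup\{a_{\varphi(i)}\}$ (the $B$-blocks). The Möbius $n$-pair $\mathfrak{M}_{(n,\varphi)}$ is the point-block structure with point set $A\cup B$ and block set $\{A_i: i\in I\}\cup\{B_i: i\in I\}$. *)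

(* Defs.v *)
From mathcomp Require Import all_boot all_fingroup.

Set Implicit Arguments.
Unset Strict Implicit.
Unset Printing Implicit Defensive.

Record point_block (T : finType) := PointBlock {
  points : {set T};
  blocks : {set {set T}}
}.

(* The index set I = {1, ..., n} is 'I_n (so indices are shifted by one), and *)
(* the families a_1, ..., a_n and b_1, ..., b_n are functions a b : 'I_n -> T *)
(* into an arbitrary ambient finite type.                                     *)

Definition pts (T : finType) (n : nat) (a : 'I_n -> T) : {set T} :=
  [set a i | i : 'I_n].

Definition Ablock (T : finType) (n : nat) (a b : 'I_n -> T) (i : 'I_n) :
    {set T} :=
  (pts a :\ a i) :|: [set b i].

Definition Bblock (T : finType) (n : nat) (phi : 'S_n) (a b : 'I_n -> T)
    (i : 'I_n) : {set T} :=
  (pts b :\ b i) :|: [set a (phi i)].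

Definition Ablocks (T : finType) (n : nat) (a b : 'I_n -> T) : {set {set T}} :=
  [set Ablock a b i | i : 'I_n].

Definition Bblocks (T : finType) (n : nat) (phi : 'S_n) (a b : 'I_n -> T) :
    {set {set T}} :=
  [set Bblock phi a b i | i : 'I_n].

Definition mobius_pair (T : finType) (n : nat) (phi : 'S_n) (a b : 'I_n -> T) :
    point_block T :=
  PointBlock (pts a :|: pts b) (Ablocks a b :|: Bblocks phi a b).

(* Main.v *)
Require Import Defs.
From mathcomp Require Import all_boot all_fingroup.

Set Implicit Arguments.
Unset Strict Implicit.
Unset Printing Implicit Defensive.

(** Two distinct A-blocks share exactly the points of A other than $a_i$ and $a_j$, since $b_i \neq
    b_j$; this gives $n-2$ ([card_AblockI]). Exchanging the families and reindexing [a] by [phi]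
    turns B-blocks into A-blocks, so the same count covers them. For a mixed pair, the only point of
    A that $B_j$ contains is $a_{\varphi(j)}$, and it lies in $A_i$ iff $\varphi(j) \neq i$; the
    only point of B that $A_i$ contains is $b_i$, and it lies in $B_j$ iff $i \neq j$. Hence $|A_i
    \cap B_j|$ is a sum of two truth values ([card_AblockIBblock]), from which (i)-(iii) are read
    off. *)

Lemma disjoint_ptsE (T : finType) (n : nat) (a b : 'I_n -> T) (i j : 'I_n) :
  [disjoint pts a & pts b] -> (a i == b j) = false.
Proof.
move=> dab; apply/eqP=> eab.
have ai : a i \in pts a by apply: imset_f.
by have := disjointFr dab ai; rewrite eab imset_f.
Qed.

(** The intersection is the injective image under [a] of the complement of [[set i; j]]. The
    families are kept arbitrary so that the lemma also serves for B-blocks. *)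
Lemma card_AblockI (T : finType) (n : nat) (a b : 'I_n -> T) (i j : 'I_n) :
  injective a -> injective b -> [disjoint pts a & pts b] -> i != j ->
  #|Ablock a b i :&: Ablock a b j| = n - 2.
Proof.
move=> a_inj b_inj dab nij.
have -> : Ablock a b i :&: Ablock a b j = a @: ~: [set i; j].
  apply/setP=> x; rewrite !inE; apply/idP/imsetP => [|[m hm ->]]; last first.
    move: hm; rewrite !inE negb_or => /andP[mi mj].
    by rewrite !(inj_eq a_inj) mi mj imset_f.
  have [/imsetP[m _ ->] | xa] := boolP (x \in pts a).
    rewrite !(inj_eq a_inj) !(disjoint_ptsE _ _ dab) !andbT !orbF => h.
    by exists m; rewrite // !inE negb_or.
  (* Outside [pts a], a common point would be both [b i] and [b j], forcing [i = j]. *)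
  rewrite !andbF /= => /andP[/eqP-> /eqP/b_inj eij].
  by rewrite eij eqxx in nij.
by rewrite (card_imset _ a_inj) cardsCs setCK cards2 nij card_ord.
Qed.

(** The two booleans, coerced to [nat], count the parts of the intersection inside and outside
    [pts a], each of which has at most one point. *)
Lemma card_AblockIBblock (T : finType) (n : nat) (phi : 'S_n)
    (a b : 'I_n -> T) (i j : 'I_n) :
  injective a -> injective b -> [disjoint pts a & pts b] ->
  #|Ablock a b i :&: Bblock phi a b j| = (phi j != i) + (i != j).
Proof.
move=> a_inj b_inj dab.
have dba : [disjoint pts b & pts a] by rewrite disjoint_sym.
have AE m : (a m \in Ablock a b i :&: Bblock phi a b j)
    = (m != i) && (m == phi j).
  rewrite !inE !(inj_eq a_inj) !(disjoint_ptsE _ _ dab) imset_f //.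
  have am : a m \in pts a by apply: imset_f.
  by rewrite (disjointFr dab am) /= !(andbT, orbF).
have BE m : (b m \in Ablock a b i :&: Bblock phi a b j)
    = (m != j) && (m == i).
  rewrite !inE !(inj_eq b_inj) !(disjoint_ptsE _ _ dba) imset_f //.
  have bm : b m \in pts b by apply: imset_f.
  by rewrite (disjointFr dba bm) /= !(andbT, orbF) andbC.
rewrite -(cardsID (pts a)); congr (_ + _).
  have -> : (Ablock a b i :&: Bblock phi a b j) :&: pts a
      = if phi j != i then [set a (phi j)] else set0.
    apply/setP=> x; rewrite in_setI.
    have [/imsetP[m _ ->] | xa] := boolP (x \in pts a).
      rewrite AE andbT; have [->|ne] := eqVneq m (phi j).
        by rewrite andbT; case: ifP; rewrite inE ?eqxx.
      by rewrite andbF; case: ifP; rewrite !inE ?(inj_eq a_inj) ?(negPf ne).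
    rewrite andbF; case: ifP; rewrite !inE // => _.
    by apply/esym/negbTE; apply: contraNneq xa => ->; apply: imset_f.
  by case: ifP; rewrite ?cards1 ?cards0.
have -> : (Ablock a b i :&: Bblock phi a b j) :\: pts a
    = if i != j then [set b i] else set0.
  apply/setP=> x; rewrite in_setD.
  have [/imsetP[m _ ->] | xb] := boolP (x \in pts b).
    have bm : b m \in pts b by apply: imset_f.
    rewrite BE (disjointFr dba bm) /=; have [->|ne] := eqVneq m i.
      by rewrite andbT; case: ifP; rewrite inE ?eqxx.
    by rewrite andbF; case: ifP; rewrite !inE ?(inj_eq b_inj) ?(negPf ne).
  (* For [x] outside [pts b] both sides are false: a point of the A-block other than [b i] lies in
     [pts a], which the difference removes. *)
  have xbi m : (x == b m) = false.
    by apply/negbTE; apply: contraNneq xb => ->; apply: imset_f.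
  have -> : (x \in if i != j then [set b i] else set0) = false.
    by case: ifP; rewrite !inE ?xbi.
  rewrite !inE xbi (negPf xb) andbF /= orbF.
  by case: (x \in pts a); rewrite ?andbF.
by case: ifP; rewrite ?cards1 ?cards0.
Qed.

Theorem proposition1p2 (n : nat) (hn : 3 <= n) (phi : 'S_n)
    (T : finType) (a b : 'I_n -> T)
    (a_inj : injective a) (b_inj : injective b)
    (ab_disj : [disjoint pts a & pts b])
    (k l : {set T})
    (hk : k \in blocks (mobius_pair phi a b))
    (hl : l \in blocks (mobius_pair phi a b))
    (hkl : k <> l) :
  let same_type :=
    (k \in Ablocks a b /\ l \in Ablocks a b) \/
    (k \in Bblocks phi a b /\ l \in Bblocks phi a b) in
  let mixed i j :=
    (k = Ablock a b i /\ l = Bblock phi a b j) \/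
    (l = Ablock a b i /\ k = Bblock phi a b j) in
  [/\ #|k :&: l| \in [:: 0; 1; 2; n - 2],
      same_type -> #|k :&: l| = n - 2,
      ~ same_type -> exists i j : 'I_n, mixed i j
    & forall i j : 'I_n, mixed i j ->
      [/\ #|Ablock a b i :&: Bblock phi a b j| = 0 <->
            (phi j = i /\ i = j),
          #|Ablock a b i :&: Bblock phi a b j| = 1 <->
            ((phi j = i /\ i <> j) \/ (phi j <> i /\ i = j))
        & #|Ablock a b i :&: Bblock phi a b j| = 2 <->
            (phi j <> i /\ i <> j)]].
Proof.
move=> same_type mixed.
(* Reindexing by [phi] adds no points, so disjointness carries over to the exchanged families. *)
have dba : [disjoint pts b & pts (a \o phi)].
  rewrite disjoint_sym; apply: disjointWl ab_disj.
  by apply/subsetP=> _ /imsetP[m _ ->]; apply: imset_f.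
(* Definitionally, [Bblock phi a b] is [Ablock b (a \o phi)]. *)
have cardBB i j : i != j -> #|Bblock phi a b i :&: Bblock phi a b j| = n - 2.
  exact: card_AblockI b_inj (inj_comp a_inj perm_inj) dba.
have cardAB i j := card_AblockIBblock phi i j a_inj b_inj ab_disj.
have same_card : same_type -> #|k :&: l| = n - 2.
  case=> -[/imsetP[i _ ek] /imsetP[j _ el]]; have nij : i != j
    by apply: contra_not_neq hkl => eij; rewrite ek el eij.
  - by rewrite ek el card_AblockI.
  - by rewrite ek el cardBB.
have same_or_mixed : same_type \/ exists i j, mixed i j.
  move: hk hl; rewrite !inE /same_type => /orP[kA|kB] /orP[lA|lB].
  - by left; left.
  - right; case/imsetP: kA lB => i _ ek /imsetP[j _ el].
    by exists i, j; left.
  - right; case/imsetP: kB lA => j _ ek /imsetP[i _ el].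
    by exists i, j; right.
  - by left; right.
split=> //.
- case: same_or_mixed => [/same_card-> | [i [j hm]]].
    by rewrite !inE eqxx !orbT.
  have -> : #|k :&: l| = (phi j != i) + (i != j).
    by rewrite -cardAB; case: hm => -[-> ->] //; rewrite setIC.
  by case: (phi j != i); case: (i != j).
- by case: same_or_mixed.
move=> i j _; rewrite cardAB.
(* Deciding [phi j = i] and [i = j] makes the cardinality a numeral, and each equivalence becomes
   propositional. *)
by case: eqP => h1; case: eqP => h2; split; split=> //=; tauto.
Qed.
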